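(* Let $k\ge 0$ and $n\ge 3$ be integers with $n\ge 2k+2$. Then the cycle $C_n$ is not $\{0,1,\ldots,k\}$-distance magic.
   Context: $C_n$ denotes the cycle on $n\ge 3$ vertices. Let $G=(V,E)$ be a finite simple undirected graph with $v=|V|$ vertices, and let $d(x,y)$ be the graph distance. For a set $D$ of nonnegative integers and $x\in V$, put $N_D(x)=\{y\in V : d(x,y)\in D\}$. A $D$-distance magic labeling of $G$ is a bijection $f:V\to\{1,2,\ldots,v\}$ for which there is a constant $\mathsf{k}$ such that $\sum_{y\in N_D(x)} f(y)=\mathsf{k}$ for every $x\in V$. $G$ is called $D$-distance magic if it admits a $D$-distance magic labeling. *)

(* Defs.v *)
From mathcomp Require Import all_boot.

Set Implicit Arguments.
Unset Strict Implicit.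
Unset Printing Implicit Defensive.

Record sgraph := SGraph {
  vertex :> finType;
  adj : rel vertex;
  adj_sym : symmetric adj;
  adj_irr : irreflexive adj }.

Arguments adj {s}.

Section Distance.
Variable G : sgraph.
Implicit Types (x y : G) (d : nat).

Definition walk x y d : bool :=
  [exists p : d.-tuple G, path adj x p && (last x p == y)].

(* Two vertices joined by a walk are joined by one with fewer than #|G| edges,
   so searching the lengths below #|G| suffices (see gdistP); None stands for
   infinite distance. *)
Definition gdist x y : option nat :=
  let d := find (walk x y) (iota 0 #|G|) in
  if d < #|G| then Some d else None.

Lemma walkP x y d :
  reflect (exists p : seq G, [/\ size p = d, path adj x p & last x p = y])
          (walk x y d).
Proof.
apply: (iffP existsP) => [[p /andP[xp /eqP lp]] | [p [sp xp lp]]].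
  by exists p; split=> //; apply: size_tuple.
by exists (Tuple (introT eqP sp)); rewrite /= xp lp eqxx.
Qed.

Lemma gdistP x y d :
  gdist x y = Some d <->
  walk x y d /\ (forall d', walk x y d' -> d <= d').
Proof.
rewrite /gdist; set s := iota 0 #|G|.
have ss : size s = #|G| by apply: size_iota.
have before d' : d' < find (walk x y) s -> ~~ walk x y d'.
  move=> ltd; have ltG : d' < #|G|.
    by rewrite -ss; apply: leq_trans ltd (find_size _ _).
  by have := before_find 0 ltd; rewrite nth_iota // add0n => ->.
have short d' : walk x y d' -> find (walk x y) s < #|G|.
  case/walkP=> p [_ xp]; case/shortenP: xp => q xq uq _ lq.
  rewrite -ss -has_find; apply/hasP; exists (size q).
    rewrite mem_iota /= add0n.
    by have := max_card [in x :: q]; rewrite (card_uniqP uq).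
  by apply/walkP; exists q.
split=> [|[wd mind]].
  case: ifP => // ltG [<-]; split=> [|d' wd'].
    have hs : has (walk x y) s by rewrite has_find ss.
    by have := nth_find 0 hs; rewrite nth_iota.
  by rewrite leqNgt; apply/negP=> /before; rewrite wd'.
have ltG := short _ wd; rewrite ltG; congr Some; apply/eqP.
rewrite eqn_leq; apply/andP; split.
  by rewrite leqNgt; apply/negP=> /before; rewrite wd.
apply: mind; have hs : has (walk x y) s by rewrite has_find ss.
by have := nth_find 0 hs; rewrite nth_iota.
Qed.

Definition nbhd (D : pred nat) x : {set G} :=
  [set y | if gdist x y is Some d then D d else false].

Definition labeling (f : G -> nat) : Prop :=
  injective f /\ (forall m, (exists x, f x = m) <-> 1 <= m <= #|G|).

Definition distance_magic_labeling (D : pred nat) (f : G -> nat) : Prop :=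
  labeling f /\ exists c, forall x, \sum_(y in nbhd D x) f y = c.

End Distance.

Definition distance_magic (G : sgraph) (D : pred nat) : Prop :=
  exists f : G -> nat, distance_magic_labeling D f.

(* ordS is the successor modulo n on {0, ..., n - 1}. *)
Definition cycle_adj n : rel 'I_n :=
  fun i j => (j == ordS i) || (i == ordS j).

Lemma cycle_adj_sym n : symmetric (@cycle_adj n).
Proof. by move=> i j; rewrite /cycle_adj orbC. Qed.

Lemma cycle_adj_irr n : 3 <= n -> irreflexive (@cycle_adj n).
Proof.
move=> n3 i; rewrite /cycle_adj orbb -val_eqE /=; apply/negbTE.
have := ltn_ord i; rewrite leq_eqVlt => /orP[/eqP eqn | ltn].
  by rewrite eqn modnn -lt0n -ltnS eqn ltnW.
by rewrite modn_small // neq_ltn ltnSn.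
Qed.

Definition cycle_graph n (n3 : 3 <= n) : sgraph :=
  SGraph (@cycle_adj_sym n) (cycle_adj_irr n3).

(* Main.v *)
Require Import Defs.
From mathcomp Require Import all_boot.
From mathcomp Require Import zify.

(** A vertex sees exactly the labels in the closed ball of radius [k] around
    it, and on a cycle with more than [2 * k + 1] vertices such a ball is an arc
    of [2 * k + 1] consecutive vertices.  Moving the centre by one step removes
    one end of the arc and adds a new vertex beyond the other end; since
    [2 * k + 1 < n] these two vertices differ.  Equal sums over the two arcs
    would force them to carry the same label, against injectivity.

    One such pair of balls is enough, so the centres [k] and [k.+1] are chosen:
    their balls are the integer intervals from [0] to [2 * k] and from [1] to
    [2 * k + 1], which do not wrap around modulo [n] ([mem_cycle_ball]). *)

(** This form needs no distances: one walk of length at most [k] suffices, not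
    necessarily a shortest one. *)
Lemma mem_ballP (G : sgraph) (k : nat) (x y : G) :
  reflect (exists2 d, d <= k & walk x y d) (y \in nbhd [pred d | d <= k] x).
Proof.
rewrite inE; apply: (iffP idP) => [|[d dk wd]].
  case E: (gdist x y) => [d|] //= dk.
  by exists d => //; case/gdistP: E.
have [m wm minm] := ex_minnP (ex_intro _ d wd).
have -> : gdist x y = Some m by apply/gdistP; split.
exact: leq_trans (minm _ wd) dk.
Qed.

Lemma walk_step (G : sgraph) (x z y : G) (d : nat) :
  walk x z d -> adj z y -> walk x y d.+1.
Proof.
case/walkP=> p [sp xp lp] zy; apply/walkP; exists (rcons p y).
by rewrite size_rcons sp rcons_path xp lp zy last_rcons.
Qed.

Section Cycle.
Variables (n : nat) (n3 : 3 <= n).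
Implicit Types c y z : cycle_graph n3.

Lemma adj_succ z y : y = z.+1 :> nat -> adj z y.
Proof.
move=> yz; apply/orP; left; rewrite -val_eqE /= modn_small ?yz //.
by rewrite -yz ltn_ord.
Qed.

Lemma adj_bounds z y :
  0 < z -> z.+1 < n -> adj z y -> z <= y.+1 /\ y <= z.+1.
Proof.
move=> z0 zn /orP[] /eqP/(congr1 val) /=; first by rewrite modn_small // => ->; lia.
have := ltn_ord y; rewrite leq_eqVlt => /orP[/eqP-> | yn].
  by rewrite modnn; lia.
by rewrite modn_small //; lia.
Qed.

Lemma walk_up d c y : y = c + d :> nat -> walk c y d.
Proof.
elim: d y => [|d IHd] y yE.
  by apply/walkP; exists [::]; split=> //; apply: val_inj; rewrite /= yE addn0.
have zn : c + d < n by have := ltn_ord y; lia.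
apply: (@walk_step _ _ (Ordinal zn : cycle_graph n3)); first exact: IHd.
by apply: adj_succ; rewrite yE addnS.
Qed.

Lemma walk_down d c y : c = y + d :> nat -> walk c y d.
Proof.
elim: d y => [|d IHd] y cE.
  by apply/walkP; exists [::]; split=> //; apply: val_inj; rewrite /= cE addn0.
have zn : y.+1 < n by have := ltn_ord c; lia.
apply: (@walk_step _ _ (Ordinal zn : cycle_graph n3)); first by apply: IHd; rewrite cE addnS.
by rewrite adj_sym; apply: adj_succ.
Qed.

(** Before its last step the walk is at integer distance less than [k] from
    [c], hence away from both [0] and [n.-1], so no step wraps around. *)
Lemma walk_bounds k c p :
  k <= c -> c + k < n -> size p <= k -> path adj c p ->
  c <= last c p + size p /\ last c p <= c + size p.
Proof.
move=> kc ckn; elim/last_ind: p => [|p y IHp]; first by rewrite /= addn0.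
rewrite size_rcons rcons_path last_rcons => pk /andP[cp zy].
have [lo hi] := IHp (ltnW pk) cp.
have [||] := @adj_bounds (last c p) y _ _ zy; lia.
Qed.

Lemma mem_cycle_ball k c y :
  k <= c -> c + k < n ->
  (y \in nbhd [pred d | d <= k] c) = (c - k <= y <= c + k).
Proof.
move=> kc ckn; apply/mem_ballP/idP => [[d dk /walkP[p [sp cp <-]]] | yB].
  by have [] := @walk_bounds k c p kc ckn _ cp; lia.
have [cy|yc] := leqP c y.
  by exists (y - c); [lia | apply: walk_up; rewrite subnKC].
by exists (c - y); [lia | apply: walk_down; rewrite subnKC // ltnW].
Qed.

End Cycle.

Theorem theorem6 (k n : nat) (n3 : 3 <= n) (hkn : 2 * k + 2 <= n) :
  ~ distance_magic (cycle_graph n3) [pred d | d <= k].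
Proof.
case=> f [[injf _] [s magic]].
have n_gt0 : 0 < n by lia.
have k_lt : k < n by lia.
have k1_lt : k.+1 < n by lia.
have end_lt : 2 * k + 1 < n by lia.
pose a : cycle_graph n3 := Ordinal n_gt0.
pose b : cycle_graph n3 := Ordinal end_lt.
(* The common part of the balls centred at k and k.+1. *)
pose M : {set cycle_graph n3} := [set y : 'I_n | 1 <= y <= 2 * k].
have ball_k : nbhd [pred d | d <= k] (Ordinal k_lt : cycle_graph n3) = a |: M.
  apply/setP=> y; rewrite mem_cycle_ball /=; [|lia..].
  by rewrite !inE -val_eqE /=; lia.
have ball_k1 : nbhd [pred d | d <= k] (Ordinal k1_lt : cycle_graph n3) = b |: M.
  apply/setP=> y; rewrite mem_cycle_ball /=; [|lia..].
  by rewrite !inE -val_eqE /=; lia.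
have aM : a \notin M by rewrite inE.
have bM : b \notin M by rewrite inE /=; lia.
have := magic (Ordinal k1_lt); rewrite -(magic (Ordinal k_lt)) ball_k ball_k1.
rewrite !big_setU1 //= => /addIn/injf/(congr1 val) /=; lia.
Qed.
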